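(* Let $n\ge1$ be an integer, let $l_{Y,n},u_{X,n},u_{Y,n}$ be positive finite constants, and let $\mathcal{P}$ be the (non-empty) class of all distributions $P$ on $\mathbb{R}^2$ such that, for $(X_{1,n},Y_{1,n})\sim P$, $\mathbb{E}[Y_{1,n}]\ge l_{Y,n}>0$, $\mathbb{E}[X_{1,n}^2]\le u_{X,n}$ and $\mathbb{E}[Y_{1,n}^2]\le u_{Y,n}$. Then for every $\varepsilon>0$ and $\tilde\varepsilon\in(0,1)$, $$\sup_{P\in\mathcal{P}}\mathbb{P}_{P^{\otimes n}}\left(\left|\frac{\overline{X}_n}{\overline{Y}_n}-\frac{\mathbb{E}[X_{1,n}]}{\mathbb{E}[Y_{1,n}]}\right|>\left(\frac{\big(\sqrt{u_{X,n}}+\varepsilon\big)\tilde\varepsilon}{(1-\tilde\varepsilon)^2}+\varepsilon\right)\frac{1}{l_{Y,n}}\right)\le\frac{u_{X,n}}{n\varepsilon^2}+\frac{u_{Y,n}-l_{Y,n}^2}{n\tilde\varepsilon^2l_{Y,n}^2}.$$ As a consequence, for every $\alpha\in(0,1)$ with $\alpha>\overline{\alpha}_n:=\frac{2(u_{Y,n}-l_{Y,n}^2)}{n\,l_{Y,n}^2}$, $$\inf_{P\in\mathcal{P}}\mathbb{P}_{P^{\otimes n}}\left(\frac{\mathbb{E}[X_{1,n}]}{\mathbb{E}[Y_{1,n}]}\in\left[\frac{\overline{X}_n}{\overline{Y}_n}-t,\frac{\overline{X}_n}{\overline{Y}_n}+t\right]\right)\ge1-\alpha,$$ with $$t=\f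rac{1}{l_{Y,n}}\left(\frac{\Big(\sqrt{u_{X,n}}+\sqrt{2u_{X,n}/(n\alpha)}\Big)\sqrt{2(u_{Y,n}-l_{Y,n}^2)/(n\alpha\,l_{Y,n}^2)}}{\Big(1-\sqrt{2(u_{Y,n}-l_{Y,n}^2)/(n\alpha\,l_{Y,n}^2)}\Big)^2}+\sqrt{\frac{2u_{X,n}}{n\alpha}}\right).$$
   Context: Under $P^{\otimes n}$, $(X_{i,n},Y_{i,n})_{i=1,\dots,n}$ are i.i.d. with distribution $P$; $\overline{X}_n,\overline{Y}_n$ are the empirical means $n^{-1}\sum_iX_{i,n}$, $n^{-1}\sum_iY_{i,n}$; the expectations in the events are taken under $P$. When $\overline{Y}_n=0$ the ratio $\overline{X}_n/\overline{Y}_n$ and the interval are undefined, and by convention neither ''the parameter belongs to the interval'' nor ''the parameter does not belong to it'' occurs on that event (so the event ''belongs to the interval'' includes only outcomes with $\overline{Y}_n\neq0$). *)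

(* Defs.v *)
From HB Require Import structures.
From mathcomp Require Import all_boot all_order all_algebra.
From mathcomp Require Import all_classical all_reals all_analysis.

Set Implicit Arguments.
Unset Strict Implicit.
Unset Printing Implicit Defensive.

Import Order.TTheory GRing.Theory Num.Theory.
Import numFieldNormedType.Exports.

Local Open Scope classical_set_scope.
Local Open Scope ring_scope.

Section tuple_cons.
Context d (T : measurableType d) (n : nat).

Definition tuple_cons (p : T * n.-tuple T) : n.+1.-tuple T :=
  [tuple of p.1 :: p.2].

Lemma measurable_tuple_cons : measurable_fun setT tuple_cons.
Proof. exact: measurable_cons measurable_fst measurable_snd. Qed.

HB.instance Definition _ :=
  isMeasurableFun.Build _ _ _ _ tuple_cons measurable_tuple_cons.

End tuple_cons.

Section iid_law.
Context d (T : measurableType d) (R : realType) (P : probability T R).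

(* The product measure of n copies of P, on n-tuples with the sigma-algebra
   generated by the coordinates; under it the coordinate maps
   [fun w => tnth w i] are i.i.d. with law P (see [iid_lawE]). *)
Fixpoint iid_law (n : nat) : probability (n.-tuple T) R :=
  if n is k.+1 then distribution (P \x iid_law k)%E (@tuple_cons _ T k)
  else \d_([tuple] : 0.-tuple T).

Lemma iid_lawE n (A : 'I_n -> set T) : (forall i, measurable (A i)) ->
  iid_law n [set w | forall i, A i (tnth w i)] = (\prod_(i < n) P (A i))%E.
Proof.
elim: n A => [|n IHn] A mA.
  by rewrite big_ord0 /= diracE mem_set// => -[].
rewrite big_ord_recl -IHn//= /distribution /pushforward.
rewrite (_ : _ @^-1` _ =
    A ord0 `*` [set w | forall i, A (lift ord0 i) (tnth w i)]); last first.
  apply/seteqP; split => [[x w] /= H|[x w] /= [Ax H] i].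
    split=> [|i]; first by have := H ord0; rewrite (tnth_nth x).
    by have := H (lift ord0 i); rewrite !(tnth_nth x).
  by case: (unliftP ord0 i) => [j|] ->;
    [have := H j; rewrite !(tnth_nth x)|rewrite (tnth_nth x)].
rewrite product_measure1E//.
rewrite (_ : [set w | _] =
    \bigcap_(i in [set: 'I_n]) ((@tnth n T)^~ i @^-1` A (lift ord0 i))).
  apply: fin_bigcap_measurable => [|i _]; first exact: finite_finset.
  by rewrite -[X in measurable X]setTI; exact: measurable_tnth.
by apply/seteqP; split => [w H i _|w H i]; exact: H.
Qed.

End iid_law.

Notation plane R := (measurableTypeR R * measurableTypeR R)%type.

Section ratio_of_means.
Context (R : realType).

Definition moment_class (lY uX uY : R) : set (probability (plane R) R) :=
  [set P : probability (plane R) R |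
    (lY%:E <= 'E_P[fun z => z.2] /\
     'E_P[fun z => (z.1 ^+ 2)%R] <= uX%:E /\
     'E_P[fun z => (z.2 ^+ 2)%R] <= uY%:E)%E].

(* [fine] only casts to R: on [moment_class] both means are finite, because
   the second moments are. *)
Definition ratio_of_expectations (P : probability (plane R) R) : R :=
  fine 'E_P[fun z => z.1] / fine 'E_P[fun z => z.2].

Definition meanX (n : nat) (w : n.-tuple (plane R)) : R :=
  n%:R^-1 * \sum_(i < n) (tnth w i).1.

Definition meanY (n : nat) (w : n.-tuple (plane R)) : R :=
  n%:R^-1 * \sum_(i < n) (tnth w i).2.

(* When [meanY w = 0] the ratio of means is undefined (while [x / 0 = 0] in
   MathComp), so the outcome is excluded from both events below; they are
   therefore not complementary. *)
Definition deviation_event (n : nat) (theta r : R) : set (n.-tuple (plane R)) :=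
  [set w | meanY w != 0 /\ `|meanX w / meanY w - theta| > r].

Definition coverage_event (n : nat) (theta t : R) : set (n.-tuple (plane R)) :=
  [set w | meanY w != 0 /\
    theta \in `[meanX w / meanY w - t, meanX w / meanY w + t]].

Definition alpha_bar (n : nat) (lY uY : R) : R :=
  2 * (uY - lY ^+ 2) / (n%:R * lY ^+ 2).

Definition half_width (n : nat) (lY uX uY alpha : R) : R :=
  let eX := Num.sqrt (2 * uX / (n%:R * alpha)) in
  let eY := Num.sqrt (2 * (uY - lY ^+ 2) / (n%:R * alpha * lY ^+ 2)) in
  lY^-1 * ((Num.sqrt uX + eX) * eY / (1 - eY) ^+ 2 + eX).

End ratio_of_means.

Arguments deviation_event {R} n theta r _.
Arguments coverage_event {R} n theta t _.

(* Main.v *)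
(** Chebyshev's inequality applied separately to the two empirical means: if
    [|meanX - E X| <= eX] and [|meanY - E Y| <= eY * E Y] with [eY < 1], then
    [meanY >= (1 - eY) * E Y > 0] and the ratio of means is within the stated
    radius of [E X / E Y].  The two failure probabilities are bounded by
    [Var X / (n eX^2)] and [Var Y / (n eY^2 (E Y)^2)], the latter being largest
    at [E Y = lY].  The confidence interval takes [eX], [eY] making each bound
    equal to [alpha / 2]; when [uY = lY^2] this forces [eY = 0], so the
    tail bound is also needed at the degenerate threshold [0]. *)
Require Import Defs.
From mathcomp Require Import all_boot all_order all_algebra.
From mathcomp Require Import all_classical all_reals all_analysis.
From mathcomp Require Import measurable_realfun ring lra.

Set Implicit Arguments.
Unset Strict Implicit.
Unset Printing Implicit Defensive.

Import Order.TTheory GRing.Theory Num.Theory.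
Import numFieldNormedType.Exports.

Local Open Scope classical_set_scope.
Local Open Scope ring_scope.

(** * Second moments of sums of centered i.i.d. variables *)

Section second_moments.
Context d (T : measurableType d) (R : realType).
Implicit Types (P : probability T R) (f : T -> R).

Lemma Lfun2_of_sqr_lty P f : measurable_fun setT f ->
  ('E_P[fun x => (f x ^+ 2)%R] < +oo)%E -> f \in Lfun P 2%:E.
Proof.
move=> mf; rewrite expectation.unlock => f2; apply/andP; split; rewrite inE//=.
rewrite /finite_norm unlock/=; apply: poweR_lty.
by under eq_integral => x _ do
  rewrite powR_mulrn ?normr_ge0// real_normK ?num_real//.
Qed.

(** The cross term [2 * c * f x] integrates to zero because [f] is centered. This evaluates the
    outer integral in the induction on the sample size. *)
Lemma expectation_sqr_shift P f (c s : R) : f \in Lfun P 2%:E ->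
  ('E_P[f] = 0)%E -> ('E_P[fun x => (f x ^+ 2)%R] = s%:E)%E ->
  ('E_P[fun x => ((c + f x) ^+ 2)%R] = (c ^+ 2 + s)%:E)%E.
Proof.
move=> f2 Ef0 Ef2.
have f1 : f \in Lfun P 1 by apply: Lfun_subset12 => //; rewrite fin_num_measure.
have ff1 : (fun x => f x ^+ 2) \in Lfun P 1.
  by apply/Lfun1_integrable; exact: Lfun2_integrable_sqr.
have -> : (fun x => (c + f x) ^+ 2) =
    (cst (c ^+ 2) \+ ((c *+ 2) \o* f \+ (fun x => f x ^+ 2))).
  by apply/funext => x /=; ring.
have cf1 : (c *+ 2) \o* f \in Lfun P 1.
  have -> : (c *+ 2) \o* f = (c *+ 2) *: f.
    by apply/funext => x /=; rewrite mulrC.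
  exact: rpredZ.
rewrite expectationD ?Lfun_cst ?rpredD//.
by rewrite expectationD// expectationZl// expectation_cst Ef0 Ef2 mule0 add0e.
Qed.

Lemma measurable_sum_tnth n f : measurable_fun setT f ->
  measurable_fun setT (fun w : n.-tuple T => \sum_(i < n) f (tnth w i)).
Proof.
move=> mf; apply: measurable_sum => i.
by apply: measurableT_comp => //; exact: measurable_tnth.
Qed.

(* The shift [c] makes the induction self-contained: integrating out the first
   coordinate [x] leaves the same integral with [c] replaced by [c + f x]. *)
Lemma expectation_sqr_iid_sum P n f (c s : R) : f \in Lfun P 2%:E ->
  ('E_P[f] = 0)%E -> ('E_P[fun x => (f x ^+ 2)%R] = s%:E)%E ->
  ('E_(iid_law P n)[fun w => ((c + \sum_(i < n) f (tnth w i)) ^+ 2)%R] =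
   (c ^+ 2 + n%:R * s)%:E)%E.
Proof.
move=> f2 Ef0 Ef2.
have mf : measurable_fun setT f by move: f2 => /andP[/[!inE]].
have s_ge0 : 0 <= s.
  by rewrite -lee_fin -Ef2; apply: expectation_ge0 => x; exact: sqr_ge0.
have mS m b : measurable_fun setT
    (fun w : m.-tuple T => (b + \sum_(i < m) f (tnth w i)) ^+ 2).
  apply: measurable_funX; apply: measurable_funD => //.
  exact: measurable_sum_tnth.
elim: n c => [|n IHn] c.
  rewrite expectation.unlock integral_dirac//; last first.
    by apply/measurable_EFinP; exact: mS.
  by rewrite diracT mul1e big_ord0 addr0 mul0r addr0.
rewrite expectation.unlock/= ge0_integral_distribution//; last 2 first.
- by apply/measurable_EFinP; exact: mS.
- by move=> w; rewrite lee_fin sqr_ge0.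
(* The integrand is a square, so Tonelli applies: the other coordinates are integrated first, with
   [x] fixed, by the induction hypothesis at [c + f x]. *)
rewrite fubini_tonelli1//; last 2 first.
- by apply: measurableT_comp => //; apply/measurable_EFinP; exact: mS.
- by move=> w; rewrite lee_fin sqr_ge0.
have inner x : (\int[iid_law P n]_w
    ((c + \sum_(i < n.+1) f (tnth (tuple_cons (x, w)) i)) ^+ 2)%:E =
    ((c + f x) ^+ 2 + n%:R * s)%:E)%E.
  rewrite -IHn expectation.unlock; apply: eq_integral => w _.
  rewrite big_ord_recl addrA (tnth_nth x)/=; congr ((_ + _) ^+ 2)%:E.
  by apply: eq_bigr => i _; rewrite !(tnth_nth x).
under eq_integral do rewrite /fubini_F/= inner.
have := expectation_sqr_shift c f2 Ef0 Ef2; rewrite expectation.unlock => Ecf.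
under eq_integral do rewrite EFinD.
rewrite ge0_integralD//; last 3 first.
- by move=> x _; rewrite lee_fin sqr_ge0.
- by apply/measurable_EFinP; apply: measurable_funX; exact: measurable_funD.
- by move=> x _; rewrite lee_fin mulr_ge0.
rewrite Ecf integral_cst//= probability_setT mule1 -EFinD; congr EFin.
by rewrite -addrA -[n.+1]addn1 natrD mulrDl mul1r [s + _]addrC.
Qed.

End second_moments.

(** * Chebyshev's inequality for an empirical mean *)

Section iid_mean.
Context d (T : measurableType d) (R : realType).
Implicit Types (P : probability T R) (f : T -> R).

(* At [e = 0] the right-hand side is the junk value [0], which is the right
   bound exactly when the variance vanishes. *)
Lemma iid_mean_chebyshev P n f (m s e : R) : (0 < n)%N -> f \in Lfun P 2%:E ->
  ('E_P[f] = m%:E)%E -> ('V_P[f] <= s%:E)%E -> 0 <= e -> (e = 0 -> s = 0) ->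
  (iid_law P n [set w | (e < `|n%:R^-1 * \sum_(i < n) f (tnth w i) - m|)%R]
   <= (s / (n%:R * e ^+ 2))%:E)%E.
Proof.
move=> n_gt0 f2 Efm Vs e_ge0 es0.
have nR_gt0 : 0 < n%:R :> R by rewrite ltr0n.
have mf : measurable_fun setT f by move: f2 => /andP[/[!inE]].
pose g x := f x - m.
have g2 : g \in Lfun P 2%:E.
  rewrite (_ : g = f - cst m)//; apply: rpredB => // [|?].
    by rewrite lee1n.
  exact: Lfun_cst.
have Eg0 : ('E_P[g] = 0)%E.
  rewrite (_ : g = f \- cst m)// expectationB ?Lfun_cst//; last first.
    by apply: Lfun_subset12 => //; rewrite fin_num_measure.
  by rewrite expectation_cst Efm subee.
have [v Vv] : exists v, 'V_P[f]%E = v%:E.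
  by exists (fine 'V_P[f]%E); rewrite fineK// variance_fin_num.
have Eg2 : ('E_P[fun x => (g x ^+ 2)%R] = v%:E)%E.
  rewrite -Vv /variance covariance.unlock Efm/=; congr expectation.
have vs : v <= s by rewrite -lee_fin -Vv.
have v_ge0 : 0 <= v by rewrite -lee_fin -Vv variance_ge0.
pose S (w : n.-tuple T) := \sum_(i < n) g (tnth w i).
have mS : measurable_fun setT S.
  by apply: measurable_sum_tnth; exact: measurable_funB.
have ES : (\int[iid_law P n]_w `|(S w ^+ 2)%:E| = (n%:R * v)%:E)%E.
  have := expectation_sqr_iid_sum n 0 g2 Eg0 Eg2.
  rewrite expr0n/= add0r expectation.unlock => <-.
  by apply: eq_integral => w _; rewrite add0r ger0_norm ?sqr_ge0.
have mS2 : measurable_fun setT (fun w => (S w ^+ 2)%:E).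
  by apply/measurable_EFinP; exact: measurable_funX.
have meanE w : n%:R^-1 * \sum_(i < n) f (tnth w i) - m = n%:R^-1 * S w.
  rewrite /S /g big_split/= sumr_const card_ord -mulr_natl.
  by field; rewrite gt_eqF.
have tailE : [set w | e < `|n%:R^-1 * \sum_(i < n) f (tnth w i) - m|] =
    [set w | (n%:R * e) ^+ 2 < S w ^+ 2].
  apply/funext => w/=; rewrite meanE normrM ger0_norm ?invr_ge0 ?ltW//.
  rewrite -ltr_pdivrMl ?invr_gt0// invrK -[S w ^+ 2]real_normK ?num_real//.
  by rewrite ltr_sqr// nnegrE// mulr_ge0// ltW.
have mtail : measurable [set w | (n%:R * e) ^+ 2 < S w ^+ 2].
  rewrite -[X in measurable X]setTI; apply: measurable_fun_ltr => //.
  exact: measurable_funX.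
rewrite tailE.
have [e0|e_neq0] := eqVneq e 0.
  (* With zero variance, [S ^+ 2] is nonnegative with zero integral, hence vanishes almost
     everywhere, and the tail is negligible. *)
  have v0 : v = 0 by apply/eqP; rewrite eq_le v_ge0 andbT -(es0 e0).
  rewrite (es0 e0) mul0r (measure_negligible mtail)//.
  have := ES; rewrite v0 mulr0 => /ae_eq_integral_abs-/(_ measurableT mS2).
  apply: negligibleS => w /=; rewrite e0 mulr0 expr0n/= => S2_gt0.
  by move=> /(_ I)[]/eqP; rewrite gt_eqF.
have a_gt0 : 0 < (n%:R * e) ^+ 2 by rewrite exprn_gt0// mulr_gt0// lt0r e_neq0.
have -> : s / (n%:R * e ^+ 2) = ((n%:R * e) ^+ 2)^-1 * (n%:R * s).
  by field; rewrite e_neq0 gt_eqF.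
rewrite EFinM lee_pdivlMl//; apply: (@le_trans _ _ (n%:R * v)%:E); last first.
  by rewrite lee_fin ler_wpM2l// ltW.
rewrite -ES.
(* Markov's inequality for [S ^+ 2] at the level [(n%:R * e) ^+ 2]. *)
apply: le_trans (le_integral_abse (iid_law P n) measurableT mS2 a_gt0).
rewrite lee_pmul2l ?lte_fin// setTI; apply: le_measure; rewrite ?inE//.
  rewrite -[X in measurable X]setTI; apply: measurable_lee => //.
  exact: measurableT_comp.
by move=> w /= /ltW; rewrite lee_fin ger0_norm// sqr_ge0.
Qed.

End iid_mean.

(** Over the common denominator [b * my], the numerator is [(a - mx) * my - mx * (b - my)], at most
    [(eX + K * eY) * my] in absolute value, while [b >= (1 - eY) * my >= (1 - eY) * l]. *)
Lemma ratio_deviation_le (R : realFieldType) (a b mx my K eX eY l : R) :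
  0 < l <= my -> `|mx| <= K -> 0 <= eX -> 0 <= eY < 1 ->
  `|a - mx| <= eX -> `|b - my| <= eY * my ->
  b != 0 /\ `|a / b - mx / my| <= l^-1 * ((K + eX) * eY / (1 - eY) ^+ 2 + eX).
Proof.
move=> /andP[l_gt0 l_my] mxK eX_ge0 /andP[eY_ge0 eY_lt1] a_mx b_my.
have my_gt0 : 0 < my by exact: lt_le_trans l_my.
have q_gt0 : 0 < 1 - eY by rewrite subr_gt0.
have qb : (1 - eY) * my <= b by move: b_my; rewrite ler_norml; lra.
have b_gt0 : 0 < b by apply: lt_le_trans qb; rewrite mulr_gt0.
have K_ge0 : 0 <= K by exact: le_trans mxK.
split; first by rewrite gt_eqF.
have -> : a / b - mx / my = ((a - mx) * my - mx * (b - my)) / (b * my).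
  by field; rewrite !gt_eqF.
rewrite normrM normfV [`|b * my|]gtr0_norm ?mulr_gt0//.
rewrite ler_pdivrMr ?mulr_gt0//.
apply: (@le_trans _ _ ((eX + K * eY) * my)).
  apply: (le_trans (ler_normB _ _)); rewrite !normrM (gtr0_norm my_gt0).
  rewrite mulrDl lerD//; first by rewrite ler_wpM2r// ltW.
  by rewrite -mulrA ler_pM.
rewrite mulrA ler_wpM2r//; first exact: ltW.
have lqb : l * (1 - eY) <= b.
  by apply: le_trans qb; rewrite mulrC ler_wpM2l// ltW.
apply: (@le_trans _ _ (l^-1 * ((K + eX) * eY / (1 - eY) ^+ 2 + eX) *
    (l * (1 - eY)))); last first.
  have ? := ltW l_gt0.
  rewrite ler_wpM2l// mulr_ge0 ?invr_ge0// addr_ge0// divr_ge0 ?sqr_ge0//.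
  by rewrite mulr_ge0// addr_ge0.
have -> : l^-1 * ((K + eX) * eY / (1 - eY) ^+ 2 + eX) * (l * (1 - eY)) =
    (K + eX) * eY / (1 - eY) + eX * (1 - eY).
  by field; rewrite ?gt_eqF.
(* After dropping the factor [1 / (1 - eY)], the terms [eX * eY] cancel and exactly [K * eY + eX]
   remains. *)
have : (K + eX) * eY <= (K + eX) * eY / (1 - eY).
  rewrite ler_pdivlMr// ler_piMr//; first by rewrite mulr_ge0 ?addr_ge0.
  by rewrite lerBlDr lerDl.
lra.
Qed.

(** Both bounds come from writing the variance as the second moment minus [m ^+ 2]; its
    nonnegativity controls [m]. The finite second moment makes the cast [fine] faithful. *)
Lemma expectation_variance_le d (T : measurableType d) (R : realType)
    (P : probability T R) (f : T -> R) (u : R) : measurable_fun setT f ->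
  ('E_P[fun x => (f x ^+ 2)%R] <= u%:E)%E ->
  let m := fine 'E_P[f]%E in
  [/\ f \in Lfun P 2%:E, ('E_P[f] = m%:E)%E, m ^+ 2 <= u &
      ('V_P[f] <= (u - m ^+ 2)%:E)%E].
Proof.
move=> mf Ef2u /=.
have f2 : f \in Lfun P 2%:E.
  by apply: Lfun2_of_sqr_lty => //; apply: le_lt_trans Ef2u _; exact: ltry.
have Efm : ('E_P[f] = (fine 'E_P[f])%:E)%E.
  rewrite fineK// expectation_fin_num//; apply: Lfun_subset12 => //.
  by rewrite fin_num_measure.
have Vle : ('V_P[f] <= (u - fine 'E_P[f] ^+ 2)%:E)%E.
  by rewrite varianceE// {1}Efm EFinB EFin_expe leeB.
split => //; rewrite -subr_ge0 -lee_fin.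
exact: le_trans (variance_ge0 P f) Vle.
Qed.

(** * Measurability and probability of the coverage event *)

Section coverage.
Context (R : realType).
Implicit Types (P : probability (plane R) R).

Lemma coverage_eventE n (theta t : R) : coverage_event n theta t =
  [set w | meanY w != 0 /\ `|meanX w / meanY w - theta| <= t].
Proof.
apply/funext => w; apply/propext.
by rewrite /coverage_event/= in_itv/= ler_distlC.
Qed.

Lemma measurable_meanX n :
  measurable_fun setT (fun w : n.-tuple (plane R) => meanX w).
Proof.
apply: measurable_funM => //.
exact: (@measurable_sum_tnth _ (plane R) R n fst).
Qed.

Lemma measurable_meanY n :
  measurable_fun setT (fun w : n.-tuple (plane R) => meanY w).
Proof.
apply: measurable_funM => //.
exact: (@measurable_sum_tnth _ (plane R) R n snd).
Qed.

Lemma measurable_meanY_eq0 n :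
  measurable [set w : n.-tuple (plane R) | meanY w == 0].
Proof.
rewrite -[X in measurable X]setTI.
by apply: measurable_fun_eqr => //; exact: measurable_meanY.
Qed.

Lemma measurable_coverage_event n (theta t : R) :
  measurable (coverage_event n theta t).
Proof.
have mX := @measurable_meanX n; have mY := @measurable_meanY n.
(* Clearing the denominator leaves a comparison of measurable functions without division. *)
have ratioE (w : n.-tuple (plane R)) : meanY w != 0 ->
    (`|meanX w / meanY w - theta| <= t) =
    (`|meanX w - theta * meanY w| <= t * `|meanY w|).
  move=> Y0; rewrite -ler_pdivrMr ?normr_gt0// -normf_div mulrBl.
  by rewrite mulfK.
rewrite coverage_eventE.
have -> : [set w : n.-tuple (plane R) | meanY w != 0 /\
      `|meanX w / meanY w - theta| <= t] =
    ~` [set w | meanY w == 0] `&`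
    [set w | `|meanX w - theta * meanY w| <= t * `|meanY w|].
  apply/seteqP; split => w /= [Y0].
    by rewrite ratioE// => ?; split=> //; exact/negP.
  by move/negP in Y0; rewrite ratioE.
apply: measurableI.
  by apply: measurableC; exact: measurable_meanY_eq0.
rewrite -[X in measurable X]setTI; apply: measurable_fun_ler => //.
  apply: measurableT_comp => //; apply: measurable_funB => //.
  exact: measurable_funM.
by apply: measurable_funM => //; exact: measurableT_comp.
Qed.

Lemma deviation_eventE n (theta r : R) : deviation_event n theta r =
  ~` [set w | meanY w == 0] `&` ~` coverage_event n theta r.
Proof.
apply/seteqP; split => w /=; rewrite coverage_eventE.
  by move=> [Y0 dev]; split => [|[_]]; [exact/negP|rewrite leNgt dev].
move=> [/negP Y0 ncov]; split => //; rewrite ltNge.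
by apply/negP => ?; exact: ncov.
Qed.

(** The complement of coverage also contains the outcomes with [meanY w = 0], so it includes the
    deviation event of the same radius, and this one bound serves both halves of the theorem. *)
Lemma noncoverage_le n (lY uX uY eX eY : R) P : (0 < n)%N -> 0 < lY ->
  moment_class lY uX uY P -> 0 < eX -> 0 <= eY < 1 ->
  (eY = 0 -> uY = lY ^+ 2) ->
  (iid_law P n (~` coverage_event n (ratio_of_expectations P)
    (lY^-1 * ((Num.sqrt uX + eX) * eY / (1 - eY) ^+ 2 + eX))) <=
   (uX / (n%:R * eX ^+ 2) +
    (uY - lY ^+ 2) / (n%:R * eY ^+ 2 * lY ^+ 2))%:E)%E.
Proof.
move=> n_gt0 lY_gt0 [EYl [EX2 EY2]] eX_gt0 /andP[eY_ge0 eY_lt1] eY0.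
have nR_gt0 : 0 < n%:R :> R by rewrite ltr0n.
have [X2 EX mx2 VX] :=
  @expectation_variance_le _ _ _ P (fun z => z.1) uX measurable_fst EX2.
have [Y2 EY my2 VY] :=
  @expectation_variance_le _ _ _ P (fun z => z.2) uY measurable_snd EY2.
rewrite /ratio_of_expectations.
set mx := fine _ in EX mx2 VX *; set my := fine _ in EY my2 VY *.
have lmy : lY <= my by rewrite -lee_fin -EY.
have my_gt0 : 0 < my by exact: lt_le_trans lmy.
have lmy2 : lY ^+ 2 <= my ^+ 2 by rewrite ler_sqr// nnegrE ltW.
set t := _ * _.
pose A := [set w : n.-tuple (plane R) | eX < `|meanX w - mx|].
pose B := [set w : n.-tuple (plane R) | eY * my < `|meanY w - my|].
have mA : measurable A.
  rewrite -[X in measurable X]setTI; apply: measurable_fun_ltr => //.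
  apply: measurableT_comp => //; apply: measurable_funB => //.
  exact: measurable_meanX.
have mB : measurable B.
  rewrite -[X in measurable X]setTI; apply: measurable_fun_ltr => //.
  apply: measurableT_comp => //; apply: measurable_funB => //.
  exact: measurable_meanY.
have PA : (iid_law P n A <= (uX / (n%:R * eX ^+ 2))%:E)%E.
  apply: (iid_mean_chebyshev n_gt0 X2 EX _ (ltW eX_gt0)).
    by apply: (le_trans VX); rewrite lee_fin lerBlDr lerDl sqr_ge0.
  by move=> eX0; rewrite eX0 ltxx in eX_gt0.
have PB : (iid_law P n B <= ((uY - my ^+ 2) / (n%:R * (eY * my) ^+ 2))%:E)%E.
  apply: (iid_mean_chebyshev n_gt0 Y2 EY VY).
    by rewrite mulr_ge0// ltW.
  (* A zero threshold forces [eY = 0], and then [lY ^+ 2 <= my ^+ 2 <= uY = lY ^+ 2] makes the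
     variance bound zero. *)
  move/eqP; rewrite mulf_eq0 [my == 0]gt_eqF// orbF => /eqP/eY0 uYE.
  by apply/eqP; rewrite eq_le !subr_le0 subr_ge0 my2 uYE lmy2.
(* Union bound: outside [A] and [B] the deterministic estimate gives coverage, including
   [meanY w != 0]. *)
apply: (@le_trans _ _ (iid_law P n (A `|` B))).
  apply: le_measure; rewrite ?inE//.
  - by apply: measurableC; exact: measurable_coverage_event.
  - exact: measurableU.
  move=> w /=; apply: contra_notP => /not_orP[/negP + /negP].
  rewrite -!leNgt coverage_eventE => hA hB; apply: ratio_deviation_le => //.
  - by rewrite lY_gt0.
  - by rewrite -sqrtr_sqr ler_wsqrtr.
  - exact: ltW.
  - by rewrite eY_ge0.
apply: le_trans (measureU2 _ mA mB) _; rewrite EFinD leeD//.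
apply: le_trans PB _; rewrite lee_fin.
(* At [eY = 0] both quotients are divisions by zero, hence both equal [0]. *)
have [->|eY_neq0] := eqVneq eY 0.
  by rewrite !(mul0r, expr0n, mulr0)/= !invr0 !mulr0.
have eY_gt0 : 0 < eY by rewrite lt0r eY_neq0.
(* In this form the bound visibly decreases in [my], so [my] may be replaced by [lY]. *)
have -> : (uY - my ^+ 2) / (n%:R * (eY * my) ^+ 2) =
    (uY / my ^+ 2 - 1) / (n%:R * eY ^+ 2).
  by field; rewrite !gt_eqF.
have -> : (uY - lY ^+ 2) / (n%:R * eY ^+ 2 * lY ^+ 2) =
    (uY / lY ^+ 2 - 1) / (n%:R * eY ^+ 2).
  by field; rewrite !gt_eqF.
rewrite ler_wpM2r//; first by rewrite invr_ge0 mulr_ge0 ?sqr_ge0// ltW.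
rewrite lerB// ler_wpM2l//; first by apply: le_trans my2; exact: sqr_ge0.
by rewrite lef_pV2// posrE exprn_gt0.
Qed.

End coverage.

Theorem theorem4p2 (R : realType) (n : nat) (lY uX uY : R)
    (n_ge1 : (1 <= n)%N) (lY_gt0 : 0 < lY) (uX_gt0 : 0 < uX) (uY_gt0 : 0 < uY)
    (class_neq0 : moment_class lY uX uY !=set0) :
  (forall eps teps : R, 0 < eps -> 0 < teps < 1 ->
    (ereal_sup
       [set iid_law P n (deviation_event n (ratio_of_expectations P)
          (((Num.sqrt uX + eps) * teps / (1 - teps) ^+ 2 + eps) * lY^-1))
       | P in moment_class lY uX uY]
     <= (uX / (n%:R * eps ^+ 2)
         + (uY - lY ^+ 2) / (n%:R * teps ^+ 2 * lY ^+ 2))%:E)%E)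
  /\
  (forall alpha : R, 0 < alpha < 1 -> alpha_bar n lY uY < alpha ->
    ((1 - alpha)%:E
     <= ereal_inf
       [set iid_law P n (coverage_event n (ratio_of_expectations P)
          (half_width n lY uX uY alpha))
       | P in moment_class lY uX uY])%E).
Proof.
split=> [eps teps eps_gt0 /andP[teps_gt0 teps_lt1]
        |alpha /andP[a_gt0 a_lt1] abar].
  apply: ge_ereal_sup => _ [P PM <-]; rewrite [X in deviation_event _ _ X]mulrC.
  set r := _ * _.
  apply: (@le_trans _ _
      (iid_law P n (~` coverage_event n (ratio_of_expectations P) r))).
    have mC : measurable (~` coverage_event n (ratio_of_expectations P) r).
      by apply: measurableC; exact: measurable_coverage_event.
    rewrite deviation_eventE; apply: le_measure; rewrite ?inE//.
    apply: measurableI => //.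
    by apply: measurableC; exact: measurable_meanY_eq0.
  apply: noncoverage_le => //; first by rewrite ltW.
  by move=> teps0; rewrite teps0 ltxx in teps_gt0.
have nR_gt0 : 0 < n%:R :> R by rewrite ltr0n.
(* Any member of the class witnesses this; it makes the argument of the square root in [eY]
   nonnegative, so that squaring [eY] recovers it. *)
have uY_ge : lY ^+ 2 <= uY.
  have [P [EYl [_ EY2]]] := class_neq0.
  have [_ EY my2 _] :=
    @expectation_variance_le _ _ _ P (fun z => z.2) uY measurable_snd EY2.
  apply: le_trans my2; rewrite ler_sqr ?nnegrE; [|exact: ltW|].
  - by rewrite -lee_fin -EY.
  - by rewrite -lee_fin -EY (le_trans _ EYl)// lee_fin ltW.
set eX := Num.sqrt (2 * uX / (n%:R * alpha)).
set eY := Num.sqrt (2 * (uY - lY ^+ 2) / (n%:R * alpha * lY ^+ 2)).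
have argY_ge0 : 0 <= 2 * (uY - lY ^+ 2) / (n%:R * alpha * lY ^+ 2).
  by rewrite divr_ge0 ?mulr_ge0 ?subr_ge0 ?sqr_ge0// ltW.
have eX2 : eX ^+ 2 = 2 * uX / (n%:R * alpha).
  by rewrite sqr_sqrtr// divr_ge0 ?mulr_ge0// ltW.
have eY2 : eY ^+ 2 = 2 * (uY - lY ^+ 2) / (n%:R * alpha * lY ^+ 2).
  by rewrite sqr_sqrtr.
have eX_gt0 : 0 < eX by rewrite sqrtr_gt0 divr_gt0 ?mulr_gt0.
(* Squared, this is the condition [alpha_bar n lY uY < alpha]. *)
have eY_lt1 : eY < 1.
  rewrite -(@ltr_sqr R) ?nnegrE ?sqrtr_ge0// expr1n eY2.
  move: abar; rewrite /alpha_bar !ltr_pdivrMr ?mulr_gt0 ?exprn_gt0//.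
  by rewrite mul1r mulrA [alpha * _]mulrC.
have eY0 : eY = 0 -> uY = lY ^+ 2.
  move=> e0; move: eY2; rewrite e0 expr0n/= => /esym/eqP.
  rewrite mulf_eq0 invr_eq0 [X in _ || X]gt_eqF ?mulr_gt0 ?exprn_gt0// orbF.
  by rewrite mulf_eq0 pnatr_eq0/= subr_eq0 => /eqP.
apply: le_ereal_inf_tmp => _ [P PM <-].
have mC := measurable_coverage_event (n:=n) (ratio_of_expectations P)
  (half_width n lY uX uY alpha).
rewrite -[X in iid_law _ _ X]setCK probability_setC; last exact: measurableC.
rewrite EFinB leeB//.
have := noncoverage_le n_ge1 lY_gt0 PM eX_gt0 _ eY0.
rewrite sqrtr_ge0 eY_lt1 => /(_ isT) /le_trans; apply; rewrite lee_fin eX2 eY2.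
have -> : uX / (n%:R * (2 * uX / (n%:R * alpha))) = alpha / 2.
  by field; rewrite !gt_eqF.
(* In the degenerate case the second term is [0] and the total is [alpha / 2]; otherwise each term
   equals [alpha / 2]. *)
have [->|uYne] := eqVneq uY (lY ^+ 2).
  by rewrite subrr mul0r addr0; lra.
have -> : (uY - lY ^+ 2) / (n%:R * (2 * (uY - lY ^+ 2) /
    (n%:R * alpha * lY ^+ 2)) * lY ^+ 2) = alpha / 2.
  by field; rewrite subr_eq0 uYne !gt_eqF.
by lra.
Qed.
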